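(* Let $\varrho\in[1/2,1)$ and let $I\subset(\max\{1,C/E_{\max}\},\infty)$ be an interval on which $$3\psi^2e^{\psi}Q^2-2QE_{\max}+C\ge 0\quad\text{for all }Q\in I.$$ Then the function $$J(Q)=F_{T_c}^{-1}(\varrho;Q)+F_{T_{\mathrm{tx}}}^{-1}(\varrho;Q)$$ is convex on $I$.
   Context: Constants: $D>0$, $\psi>0$, $\kappa>0$, $P_{s,\max}>0$, $f_{\max}>0$, $E_{\max}>0$, $\varepsilon\in(0,1)$, $\eta>0$, $n_p>0$, $t_p>0$. Define $C=\frac{D}{(1-\varepsilon)\eta}$ and $$f_c^*(Q)=\sqrt{\frac{(E_{\max}-C/Q)\,f_{\max}^3}{(e^{\psi Q}-e^{\psi})\,D\,P_{s,\max}}}.$$ Compression time: $T_c\sim\mathrm{Gamma}\big(\kappa,\ \tfrac{(e^{\psi Q}-e^{\psi})D}{\kappa f_c^*(Q)}\big)$, with shape $\kappa$ and the given scale. Its $\varrho$-quantile is denoted $F_{T_c}^{-1}(\varrho;Q)$. Transmission time: with $N=D/(Qn_p)$, $T_{\mathrm{tx}}$ is Gaussian with mean $\mu_{\mathrm{tx}}=\frac{Nt_p}{1-\varepsilon}$ and variance $\sigma_{\mathrm{tx}}^2=\frac{Nt_p^2\varepsilon}{(1-\varepsilon)^2}$. Hence $$F_{T_{\mathrm{tx}}}^{-1}(\varrho;Q)=\mu_{\mathrm{tx}}+z(\varrho)\sigma_{\mathrm{tx}},$$ where $z$ is the standard normal inverse CDF. *)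

(* Defs.v *)
From HB Require Import structures.
From mathcomp Require Import all_boot all_order all_algebra.
From mathcomp Require Import all_classical all_reals all_analysis.
Set Implicit Arguments. Unset Strict Implicit. Unset Printing Implicit Defensive.
Import Order.TTheory GRing.Theory Num.Def Num.Theory.
Local Open Scope classical_set_scope.
Local Open Scope ring_scope.

Section defs.
Variable R : realType.

Definition quantile (F : R -> R) (p : R) : R := inf [set x | p <= F x].

Definition gamma_kernel (k th t : R) : R := (t `^ (k - 1)) * expR (- t / th).

Definition gamma_cdf (k th x : R) : R :=
  fine (\int[lebesgue_measure]_(t in `]0, x]) (gamma_kernel k th t)%:E) /
  fine (\int[lebesgue_measure]_(t in `]0, +oo[) (gamma_kernel k th t)%:E).

Definition gamma_quantile (k th p : R) : R := quantile (gamma_cdf k th) p.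

Definition std_normal_cdf (x : R) : R :=
  fine (\int[lebesgue_measure]_(t in `]-oo, x]) (normal_pdf 0 1 t)%:E).

Definition z_quantile (p : R) : R := quantile std_normal_cdf p.

Definition Cconst (D eps eta : R) : R := D / ((1 - eps) * eta).

Definition fc_star (D psi Psmax fmax Emax eps eta Q : R) : R :=
  Num.sqrt (((Emax - Cconst D eps eta / Q) * fmax ^+ 3) /
            ((expR (psi * Q) - expR psi) * D * Psmax)).

Definition Tc_scale (D psi kappa Psmax fmax Emax eps eta Q : R) : R :=
  (expR (psi * Q) - expR psi) * D /
  (kappa * fc_star D psi Psmax fmax Emax eps eta Q).

Definition FTc_inv (D psi kappa Psmax fmax Emax eps eta rho Q : R) : R :=
  gamma_quantile kappa (Tc_scale D psi kappa Psmax fmax Emax eps eta Q) rho.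

Definition Npk (D np Q : R) : R := D / (Q * np).
Definition mu_tx (D np tp eps Q : R) : R := Npk D np Q * tp / (1 - eps).
Definition sigma_tx (D np tp eps Q : R) : R :=
  Num.sqrt (Npk D np Q * tp ^+ 2 * eps / (1 - eps) ^+ 2).

Definition FTtx_inv (D np tp eps rho Q : R) : R :=
  mu_tx D np tp eps Q + z_quantile rho * sigma_tx D np tp eps Q.

Definition Jfun (D psi kappa Psmax fmax Emax eps eta np tp rho Q : R) : R :=
  FTc_inv D psi kappa Psmax fmax Emax eps eta rho Q + FTtx_inv D np tp eps rho Q.

Definition convex_on (I : set R) (f : R -> R) : Prop :=
  forall x y t, I x -> I y -> 0 <= t -> t <= 1 ->
    f (t * x + (1 - t) * y) <= t * f x + (1 - t) * f y.

End defs.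

(* Main.v *)
(* Up to constants, J is u ^ (3/2) / v ^ (1/2) + 1 / Q + 1 / Q ^ (1/2) with
   u = e ^ (psi Q) - e ^ psi convex and v = Emax - C / Q concave: the quantile of
   a Gamma law is proportional to its scale, and z(rho) >= 0 as rho >= 1/2.
   The function u ^ (3/2) / v ^ (1/2) is jointly convex, increasing in u and
   decreasing in v, so its composition with u and v is convex; taking (1, Q) for
   (u, v) also settles the last term. *)
Require Import Defs.
From HB Require Import structures.
From mathcomp Require Import all_boot all_order all_algebra.
From mathcomp Require Import all_classical all_reals all_analysis.
From mathcomp Require Import measurable_realfun ring lra.
Import Order.TTheory GRing.Theory Num.Def Num.Theory.
Local Open Scope classical_set_scope.
Local Open Scope ring_scope.

(** * Convexity by supporting lines, and the perspective function *)

Section convexity.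
Set Implicit Arguments.
Unset Strict Implicit.
Unset Printing Implicit Defensive.
Context {R : realType}.
Implicit Types (I : set R) (f g u v : R -> R).

Lemma is_interval_conv I x y t : is_interval I -> I x -> I y ->
  0 <= t -> t <= 1 -> I (t * x + (1 - t) * y).
Proof.
move=> hI Ix Iy t0 t1; have [xy|/ltW yx] := leP x y.
- by apply: (hI _ _ Ix Iy); apply/andP; split; nra.
- by apply: (hI _ _ Iy Ix); apply/andP; split; nra.
Qed.

Lemma convex_on_eq I f g : is_interval I -> (forall x, I x -> f x = g x) ->
  convex_on I f -> convex_on I g.
Proof.
move=> hI fg cf x y t Ix Iy t0 t1.
by rewrite -!fg//; [exact: cf | exact: is_interval_conv].
Qed.

Lemma convex_onD I f g : convex_on I f -> convex_on I g ->
  convex_on I (fun x => f x + g x).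
Proof.
move=> cf cg x y t Ix Iy t0 t1.
have := cf x y t Ix Iy t0 t1; have := cg x y t Ix Iy t0 t1; nra.
Qed.

Lemma convex_onZ I f c : 0 <= c -> convex_on I f ->
  convex_on I (fun x => c * f x).
Proof.
move=> c0 cf x y t Ix Iy t0 t1.
have := ler_wpM2l c0 (cf x y t Ix Iy t0 t1); nra.
Qed.

Lemma convex_on_cst I c : convex_on I (cst c).
Proof. by move=> x y t _ _ _ _ /=; lra. Qed.

Lemma convex_on_opp I : convex_on I -%R.
Proof. by move=> x y t _ _ _ _; lra. Qed.

(** Take [m] to be the point [t * x + (1 - t) * y]: in the weighted average of the supporting lines
    at [x] and [y] the slope terms cancel, leaving [f m]. Since [s] is an arbitrary function, no
    derivative has to be computed. *)
Lemma convex_on_tangent I f (s : R -> R) : is_interval I ->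
  (forall x m, I x -> I m -> f m + s m * (x - m) <= f x) -> convex_on I f.
Proof.
move=> hI tan x y t Ix Iy t0 t1.
have Im := is_interval_conv hI Ix Iy t0 t1.
have := ler_wpM2l t0 (tan _ _ Ix Im).
have t1' : 0 <= 1 - t by lra.
have := ler_wpM2l t1' (tan _ _ Iy Im).
set m := t * x + (1 - t) * y.
have -> : x - m = (1 - t) * (x - y) by rewrite /m; ring.
have -> : y - m = - t * (x - y) by rewrite /m; ring.
lra.
Qed.

Lemma convex_on_expR I a : is_interval I ->
  convex_on I (fun x => expR (a * x)).
Proof.
move=> hI; apply: (@convex_on_tangent _ _ (fun m => expR (a * m) * a)) => //.
move=> x m _ _; have -> : a * x = a * m + a * (x - m) by ring.
rewrite expRD; have := ler_wpM2l (expR_ge0 (a * m)) (expR_ge1Dx (a * (x - m))).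
lra.
Qed.

Lemma convex_on_inv I : is_interval I -> (forall x, I x -> 0 < x) ->
  convex_on I (fun x => x^-1).
Proof.
move=> hI pos.
apply: (@convex_on_tangent _ _ (fun m => - (m^-1) ^+ 2)) => // x m Ix Im.
have [x0 m0] := (pos _ Ix, pos _ Im).
rewrite -subr_ge0.
(* The gap between the graph and its tangent has a double zero at [m], and the cofactor is
   positive. *)
have -> : x^-1 - (m^-1 + - m^-1 ^+ 2 * (x - m)) = (x - m) ^+ 2 * (x^-1 * m^-1 ^+ 2).
  by field; rewrite !gt_eqF.
by rewrite mulr_ge0 ?sqr_ge0// mulr_ge0 ?sqr_ge0// invr_ge0 ltW.
Qed.

(* The function (u, v) |-> u ^ (3/2) / v ^ (1/2) is the perspective of
   r |-> r ^ 3 in the variable r = (u / v) ^ (1/2); being homogeneous of degree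
   1, it dominates its tangent plane 3/2 r0 u - 1/2 r0 ^ 3 v at every r0. *)
Lemma convex_on_perspective I u v : is_interval I ->
  (forall x, I x -> 0 <= u x) -> (forall x, I x -> 0 < v x) ->
  convex_on I u -> convex_on I (fun x => - v x) ->
  convex_on I (fun x => u x * Num.sqrt (u x / v x)).
Proof.
move=> hI u0 v0 cu cv x y t Ix Iy t0 t1.
have Im := is_interval_conv hI Ix Iy t0 t1.
pose r z := Num.sqrt (u z / v z).
have r0 z : 0 <= r z by exact: sqrtr_ge0.
have ur z : I z -> u z = r z ^+ 2 * v z.
  move=> Iz; rewrite sqr_sqrtr ?divr_ge0 ?u0 ?(ltW (v0 _ Iz))//.
  by rewrite divfK// gt_eqF// v0.
set m := t * x + (1 - t) * y in Im *.
have tan z : I z ->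
    3 / 2 * r m * u z - 1 / 2 * r m ^+ 3 * v z <= u z * r z.
  move=> Iz; rewrite -subr_ge0 (ur z)//.
  (* The plane touches the graph at [r m], so the difference has a double root there; the remaining
     factor [2 * r z + r m] is nonnegative. *)
  have -> : r z ^+ 2 * v z * r z -
      (3 / 2 * r m * (r z ^+ 2 * v z) - 1 / 2 * r m ^+ 3 * v z) =
      1 / 2 * (v z * ((r z - r m) ^+ 2 * (2 * r z + r m))) by field.
  rewrite mulr_ge0//.
  rewrite mulr_ge0 ?(ltW (v0 _ Iz))// mulr_ge0 ?sqr_ge0//.
  by have := r0 z; have := r0 m; lra.
(* At the contact point the plane attains the function, so the left-hand side becomes linear in
   [u m] and [v m]. *)
have -> : u m * Num.sqrt (u m / v m) =
    3 / 2 * r m * u m - 1 / 2 * r m ^+ 3 * v m.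
  by rewrite -/(r m) (ur m)//; field.
have t1' : 0 <= 1 - t by lra.
apply: le_trans (lerD (ler_wpM2l t0 (tan _ Ix)) (ler_wpM2l t1' (tan _ Iy))).
(* The signs of the two coefficients make the plane increasing in [u] and decreasing in [v], so the
   convexity of [u] and of [- v] can be applied termwise. *)
have c1 : 0 <= 3 / 2 * r m by rewrite mulr_ge0//; lra.
have c3 : 0 <= 1 / 2 * r m ^+ 3 by rewrite mulr_ge0 ?exprn_ge0//; lra.
have := ler_wpM2l c1 (cu _ _ _ Ix Iy t0 t1).
have := ler_wpM2l c3 (cv _ _ _ Ix Iy t0 t1).
rewrite -/m /=; lra.
Qed.

End convexity.

(** * Scaling of integrals and of Gamma quantiles *)

Section quantiles.
Set Implicit Arguments.
Unset Strict Implicit.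
Unset Printing Implicit Defensive.
Context {R : realType}.
Local Notation mu := (@lebesgue_measure R).

Lemma measurable_scale (c : R) :
  measurable_fun setT ( *%R c : measurableTypeR R -> measurableTypeR R).
Proof. exact: mulrl_measurable. Qed.

(* The instance is named explicitly because inference leaves its measurability
   argument unresolved. *)
Definition scaled_lebesgue (c : {posnum R}) :
    {measure set (measurableTypeR R) -> \bar R} :=
  mscale c%:num%:nng
    (measure_function_pushforward__canonical__measure_function_Measure mu
       (measurable_scale c%:num)).

(** Lebesgue measure is the only measure giving half-open intervals their length, and the factor [c]
    compensates the shrinking of the preimage under [x |-> c * x]. *)
Lemma scaled_lebesgueE (c : {posnum R}) (A : set R) : measurable A ->
  scaled_lebesgue c A = mu A.
Proof.
move=> mA; apply/esym/lebesgue_measure_unique => //= _ [[a b]] _ <-.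
rewrite /scaled_lebesgue/= /mscale/= /pushforward /=.
have -> : *%R c%:num @^-1` `]a, b] = `]a / c%:num, b / c%:num]%classic.
  apply/seteqP; split => x /=; rewrite !in_itv/= ltr_pdivrMr// ler_pdivlMr//;
    by rewrite (mulrC x).
rewrite !lebesgue_measure_itv/= !lte_fin ltr_pM2r ?invr_gt0//.
case: ifPn => ab; last by rewrite mule0.
by rewrite -!EFinD -EFinM; congr EFin; field.
Qed.

Lemma ge0_integral_scale (c : {posnum R}) (D : set R) (f : R -> \bar R) :
  measurable D -> measurable_fun [set: R] f -> (forall x, (0 <= f x)%E) ->
  (\int[mu]_(x in D) f x =
   c%:num%:E * \int[mu]_(x in [set x | D (c%:num * x)%R]) f (c%:num * x)%R)%E.
Proof.
move=> mD mf f0.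
transitivity (\int[scaled_lebesgue c]_(x in D) f x)%E.
  by apply: eq_measure_integral => A mA _; exact/esym/scaled_lebesgueE.
rewrite ge0_integral_mscale//; last exact: measurable_funS mf.
congr (_ * _)%E.
apply: (ge0_integral_pushforward (measurable_scale c%:num) mu) => //.
exact: measurable_funS mf.
Qed.

Lemma measurable_gamma_kernel (k th : R) :
  measurable_fun [set: R] (gamma_kernel k th).
Proof.
apply: measurable_funM; first exact: measurable_powR.
by apply: measurableT_comp => //; apply: measurable_funM => //; exact: oppr_measurable.
Qed.

(** Under the substitution [t = th * x], the Jacobian gives [th] and the power gives [th ^ (k - 1)].
    Positivity on [D] allows the power of the product to split. *)
Lemma integral_gamma_kernel_scale (k th : R) (D : set R) : 0 < th ->
  measurable D -> D `<=` [set x | 0 < x] ->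
  (\int[mu]_(x in D) (gamma_kernel k th x)%:E =
   (th `^ k)%:E *
     \int[mu]_(x in [set x | D (th * x)%R]) (gamma_kernel k 1 x)%:E)%E.
Proof.
move=> th0 mD Dpos.
have mE c : measurable_fun [set: R] (EFin \o gamma_kernel k c).
  by apply/measurable_EFinP; exact: measurable_gamma_kernel.
have k0 c x : (0 <= (gamma_kernel k c x)%:E)%E.
  by rewrite lee_fin mulr_ge0 ?powR_ge0 ?expR_ge0.
have mD' : measurable [set x | D (th * x)].
  by rewrite -[X in measurable X]setTI; exact: mulrl_measurable.
rewrite (@ge0_integral_scale (PosNum th0) D)//=; last exact: mE.
have -> : (\int[mu]_(x in [set x | D (th * x)%R]) (gamma_kernel k th (th * x))%:E =
    (th `^ (k - 1))%:E *
      \int[mu]_(x in [set x | D (th * x)%R]) (gamma_kernel k 1 x)%:E)%E.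
  rewrite -ge0_integralZl_EFin ?powR_ge0//; last exact: measurable_funS (mE 1).
  apply: eq_integral => x /[!inE]/= /Dpos/= thx0.
  have x0 : 0 <= x by rewrite -(pmulr_rge0 _ th0) ltW.
  rewrite -EFinM /gamma_kernel powRM ?(ltW th0)// -mulrA divr1.
  by rewrite -mulrN mulrAC divff ?gt_eqF// mul1r.
rewrite muleA -EFinM; congr (_%:E * _)%E.
by rewrite -[X in X * _](powRr1 (ltW th0)) -powRD ?(gt_eqF th0) ?implybT// addrC subrK.
Qed.

(** The factor [th ^ k] appears in both the numerator and the normalising integral, and cancels. *)
Lemma gamma_cdf_scale (k th x : R) : 0 < th ->
  gamma_cdf k th x = gamma_cdf k 1 (x / th).
Proof.
move=> th0; rewrite /gamma_cdf.
rewrite !(@integral_gamma_kernel_scale _ th)//; last 2 first.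
- by move=> y /=; rewrite in_itv/= => /andP[].
- by move=> y /=; rewrite in_itv/= => /andP[].
have -> : [set y | (`]0, x]%classic : set R) (th * y)] = `]0, x / th]%classic.
  by apply/seteqP; split => y /=; rewrite !in_itv/= pmulr_rgt0// ler_pdivlMr// mulrC.
have -> : [set y | (`]0, +oo[%classic : set R) (th * y)] = `]0, +oo[%classic.
  by apply/seteqP; split => y /=; rewrite !in_itv/= pmulr_rgt0.
(* A positive factor keeps infinities infinite and [fine] sends them to 0, so the factor comes out
   for every extended real. *)
have fZ (e : \bar R) : fine ((th `^ k)%:E * e) = th `^ k * fine e.
  have thk : 0 < th `^ k by exact: powR_gt0.
  by case: e => [r| |]//=; rewrite ?gt0_mulye ?gt0_mulNye ?gt0_muley ?gt0_muleNy ?lte_fin//= mulr0.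
by rewrite !fZ -mulf_div divff ?mul1r// gt_eqF// powR_gt0.
Qed.

Lemma inf_scale (c : R) (A : set R) : 0 < c -> has_lbound A ->
  inf [set x | A (x / c)] = c * inf A.
Proof.
(* On the empty set both sides are 0, the default value of [inf]. *)
move=> c0 lA; have [->|/set0P[a Aa]] := eqVneq A set0.
  by rewrite (_ : [set _ | _] = set0)// inf0 mulr0.
have cA b : A b -> A (c * b / c) by rewrite mulrAC divff ?gt_eqF// mul1r.
have lb : lbound [set x | A (x / c)] (c * inf A).
  by move=> x /= Ax; rewrite mulrC -ler_pdivlMr//; exact: ge_inf.
apply/eqP; rewrite eq_le; apply/andP; split.
- rewrite mulrC -ler_pdivrMr//; apply: lb_le_inf; first by exists a.
  move=> b Ab; rewrite ler_pdivrMr// mulrC.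
  by apply: ge_inf; [exists (c * inf A) | exact: cA].
- by apply: lb_le_inf => //; exists (c * a); exact: cA.
Qed.

Lemma quantile_scale (F : R -> R) (c p : R) : 0 < c ->
  has_lbound [set x | p <= F x] ->
  quantile (fun x => F (x / c)) p = c * quantile F p.
Proof. exact: inf_scale. Qed.

Lemma gamma_cdf_le0 (k th x : R) : x <= 0 -> gamma_cdf k th x = 0.
Proof.
by move=> x0; rewrite /gamma_cdf set_itv_ge ?integral_set0 ?mul0r// bnd_simp -leNgt.
Qed.

(** The distribution function vanishes on nonpositive reals, so it reaches [p > 0] only at positive
    ones. This gives both the lower bound required for scaling the infimum and the sign of the
    quantile. *)
Lemma gamma_quantile_lbound (k p : R) : 0 < p ->
  lbound [set x | p <= gamma_cdf k 1 x] 0.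
Proof.
move=> p0 x /=; apply: contraTT; rewrite -!ltNge => /ltW x0.
by rewrite gamma_cdf_le0.
Qed.

Lemma gamma_quantile_scale (k th p : R) : 0 < th -> 0 < p ->
  gamma_quantile k th p = th * gamma_quantile k 1 p.
Proof.
move=> th0 p0; rewrite /gamma_quantile.
have -> : gamma_cdf k th = fun x => gamma_cdf k 1 (x / th).
  by apply/funext => x; exact: gamma_cdf_scale.
by apply: quantile_scale => //; exists 0; exact: gamma_quantile_lbound.
Qed.

Lemma inf_ge0 (A : set R) : lbound A 0 -> 0 <= inf A.
Proof.
have [->|A0] := eqVneq A set0; first by rewrite inf0.
by move=> ?; apply: lb_le_inf => //; exact/set0P.
Qed.

Lemma gamma_quantile_ge0 (k p : R) : 0 < p -> 0 <= gamma_quantile k 1 p.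
Proof. by move=> p0; apply: inf_ge0; exact: gamma_quantile_lbound. Qed.

(** * Sign of the standard normal quantile *)

Local Notation pdf := (@normal_pdf R 0 1).

Lemma normal_pdfN (x : R) : pdf (- x) = pdf x.
Proof.
by rewrite !normal_pdfE ?oner_neq0// /normal_fun !subr0 sqrrN.
Qed.

Lemma measurable_pdf (D : set R) : measurable_fun D (EFin \o pdf).
Proof.
apply/measurable_EFinP/measurable_funTS; exact: measurable_normal_pdf.
Qed.

(** The density is even and Lebesgue measure is invariant under negation. *)
Lemma integral_pdf_reflect (x : R) :
  (\int[mu]_(t in `]-oo, x]) (pdf t)%:E =
   \int[mu]_(t in `[(- x)%R, +oo[) (pdf t)%:E)%E.
Proof.
rewrite (_ : `]-oo, x]%classic =
    (-%R : measurableTypeR R -> measurableTypeR R) @^-1` `[- x, +oo[); last first.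
  by rewrite opp_preimage_itvbndy opprK.
transitivity (\int[pushforward mu (-%R : measurableTypeR R -> measurableTypeR R)]_(t in `[(- x)%R, +oo[) (pdf t)%:E)%E.
  rewrite ge0_integral_pushforward//=.
  - by apply: eq_integral => t _; rewrite normal_pdfN.
  - exact: measurable_pdf.
  - by move=> t _; rewrite lee_fin normal_pdf_ge0.
by apply: eq_measure_integral => //= A mA _; exact: lebesgue_measureN.
Qed.

Lemma normal_pdf_gt0 (x : R) : 0 < pdf x.
Proof.
rewrite normal_pdfE ?oner_neq0// mulr_gt0 ?expR_gt0//.
by rewrite normal_peak_gt0 ?oner_neq0.
Qed.

Lemma normal_pdf_le (x t : R) : `|t| <= `|x| -> pdf x <= pdf t.
Proof.
move=> tx; rewrite !normal_pdfE ?oner_neq0// ler_wpM2l ?normal_peak_ge0//.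
rewrite /normal_fun !subr0 ler_expR ler_wpM2r//.
by rewrite lerN2 -(real_normK (num_real t)) -(real_normK (num_real x)) lerXn2r ?nnegrE.
Qed.

(* By symmetry, twice the mass of ]-oo, x] plus that of ]x, -x[ is 1. *)
Lemma std_normal_cdf_lt_half (x : R) : x < 0 -> std_normal_cdf x < 1 / 2.
Proof.
move=> x0; pose P := normal_prob (0 : R) 1.
have PE A : P A = (\int[mu]_(t in A) (pdf t)%:E)%E by [].
have PL : P `]-oo, x]%classic = P `[- x, +oo[%classic by exact: integral_pdf_reflect.
have PT : (P `]-oo, x]%classic + P `]x, (- x)%R[%classic + P `[(- x)%R, +oo[%classic = 1)%E.
  rewrite -(@probability_setT _ _ _ P).
  have -> : [set: R] = `]-oo, x]%classic `|` `]x, (- x)[%classic `|` `[- x, +oo[%classic.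
    apply/esym/seteqP; split => // t _ /=; rewrite !in_itv/= andbT.
    have [tx|tx] := leP t x; first by left; left.
    by have [xt|xt] := leP (- x) t; [right | left; right].
  rewrite !measureU//.
  - apply/seteqP; split => // t /=; rewrite !in_itv/= => -[tx /andP[xt _]].
    by move: (le_lt_trans tx xt); rewrite ltxx.
  - exact: measurableU.
  - apply/seteqP; split => // t /=; rewrite !in_itv/= andbT => -[[tx|/andP[_ tx]] xt].
      by have := le_trans xt tx; lra.
    by move: (le_lt_trans xt tx); rewrite ltxx.
have PM : (0 < P `]x, (- x)%R[%classic)%E.
  (* On []x, -x[] the density is at least its endpoint value [pdf x], so the mass is at least
     [pdf x] times the positive length [-2x]. *)
  apply: (@lt_le_trans _ _ ((pdf x)%:E * mu `]x, (- x)%R[%classic)%E).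
    rewrite lebesgue_measure_itv/= lte_fin ifT; last lra.
    by rewrite -EFinD -EFinM lte_fin mulr_gt0 ?normal_pdf_gt0//; lra.
  rewrite -integral_cst//; apply: ge0_le_integral => //.
  - by move=> t _; rewrite lee_fin normal_pdf_ge0.
  - exact: measurable_pdf.
  - move=> t /=; rewrite in_itv/= => /andP[xt tx]; rewrite lee_fin normal_pdf_le//.
    by rewrite (ltr0_norm x0) ler_norml; apply/andP; split; lra.
rewrite /std_normal_cdf -PE; move: PT PM; rewrite -PL.
have fP A : measurable A -> P A = (fine (P A))%:E.
  by move=> mA; rewrite fineK// fin_num_measure.
rewrite (fP `]-oo, x]%classic)// (fP `]x, (- x)[%classic)//=.
by rewrite -!EFinD lte_fin => -[]; lra.
Qed.

(** No negative number belongs to the set whose infimum is the quantile, as the distribution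
    function is below 1/2 there. *)
Lemma z_quantile_ge0 (p : R) : 1 / 2 <= p -> 0 <= z_quantile p.
Proof.
move=> p2; apply: inf_ge0 => x /=; apply: contraTT; rewrite -!ltNge.
by move=> /std_normal_cdf_lt_half/lt_le_trans; apply.
Qed.

End quantiles.

Theorem theorem1 (R : realType)
  (D psi kappa Psmax fmax Emax eps eta np tp rho : R) (I : set R) :
  0 < D -> 0 < psi -> 0 < kappa -> 0 < Psmax -> 0 < fmax -> 0 < Emax ->
  0 < eps -> eps < 1 -> 0 < eta -> 0 < np -> 0 < tp ->
  1 / 2 <= rho -> rho < 1 ->
  is_interval I ->
  (forall Q, I Q -> Num.max 1 (Cconst D eps eta / Emax) < Q) ->
  (forall Q, I Q ->
     0 <= 3 * psi ^+ 2 * expR psi * Q ^+ 2 - 2 * Q * Emax + Cconst D eps eta) ->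
  convex_on I (Jfun D psi kappa Psmax fmax Emax eps eta np tp rho).
Proof.
move=> D0 psi0 kappa0 P0 f0 E0 eps0 eps1 eta0 np0 tp0 rho2 _ hI IQ _.
pose C := Cconst D eps eta.
have C0 : 0 <= C by rewrite divr_ge0 ?mulr_ge0//; lra.
have rho0 : 0 < rho by lra.
have I1 Q : I Q -> 1 < Q by move=> /IQ; rewrite gt_max => /andP[].
have I0 Q : I Q -> 0 < Q by move=> /I1; lra.
pose u Q := expR (psi * Q) - expR psi.
pose v Q := Emax - C / Q.
have u0 Q : I Q -> 0 < u Q.
  by move=> /I1 Q1; rewrite subr_gt0 ltr_expR -[ltLHS]mulr1 ltr_pM2l.
have v0 Q : I Q -> 0 < v Q.
  move=> IQ'; have := IQ _ IQ'; rewrite gt_max -/C => /andP[_ CQ].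
  by rewrite subr_gt0 ltr_pdivrMr ?I0// mulrC -ltr_pdivrMr.
have cinv : convex_on I (fun Q => Q^-1) by exact: convex_on_inv.
have cu : convex_on I u.
  by apply: convex_onD; [exact: convex_on_expR | exact: convex_on_cst].
have cv : convex_on I (fun Q => - v Q).
  apply: (@convex_on_eq _ _ (fun Q => C * Q^-1 + - Emax)) => //.
    by move=> Q _; rewrite /v; ring.
  by apply: convex_onD; [exact: convex_onZ | exact: convex_on_cst].
(* These constants collect all that does not depend on [Q]: [c1] comes from the compression time,
   [c2] from the mean and [c3] from the standard deviation of the transmission time, through
   [N = D / (Q * np)]. *)
pose c1 := gamma_quantile kappa 1 rho * (D / kappa * Num.sqrt (D * Psmax / fmax ^+ 3)).
pose c2 := D / np * tp / (1 - eps).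
pose c3 := z_quantile rho * Num.sqrt (D / np * tp ^+ 2 * eps / (1 - eps) ^+ 2).
apply: (@convex_on_eq _ _ (fun Q => c1 * (u Q * Num.sqrt (u Q / v Q)) +
    (c2 * Q^-1 + c3 * (1 * Num.sqrt (1 / Q))))) => //; last first.
  apply: convex_onD; last apply: convex_onD.
  - apply: convex_onZ; last by apply: convex_on_perspective => // Q /u0/ltW.
    by rewrite mulr_ge0 ?gamma_quantile_ge0// mulr_ge0 ?sqrtr_ge0// divr_ge0// ltW.
  - by apply: convex_onZ => //; rewrite !(mulr_ge0, invr_ge0) ?subr_ge0// ltW.
  - apply: convex_onZ; first by rewrite mulr_ge0 ?sqrtr_ge0 ?z_quantile_ge0.
    apply: (@convex_on_perspective _ _ (cst 1) id) => //.
    + exact: convex_on_cst.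
    + exact: convex_on_opp.
move=> Q IQ'; have [[u0' v0'] Q0] := (u0 _ IQ', v0 _ IQ', I0 _ IQ').
(* Writing the frequency as an inverse turns the scale [u * D / (kappa * fc_star)] into a constant
   times [u * sqrt (u / v)], the form of the perspective lemma. *)
have fc : fc_star D psi Psmax fmax Emax eps eta Q =
    (Num.sqrt (D * Psmax / fmax ^+ 3) * Num.sqrt (u Q / v Q))^-1.
  rewrite -sqrtrM ?divr_ge0 ?mulr_ge0 ?exprn_ge0 ?ltW// -sqrtrV; last first.
    by rewrite !(mulr_ge0, invr_ge0) ?exprn_ge0// ltW.
  congr Num.sqrt; rewrite -/C -/(u Q) -/(v Q); field.
  by rewrite !lt0r_neq0.
rewrite /Jfun /FTc_inv /FTtx_inv; congr (_ + (_ + _)).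
- rewrite gamma_quantile_scale//; last first.
    rewrite divr_gt0 ?mulr_gt0// fc invr_gt0 mulr_gt0 ?sqrtr_gt0//.
      by rewrite divr_gt0 ?mulr_gt0 ?exprn_gt0.
    by rewrite divr_gt0.
  by rewrite /Tc_scale fc -/(u Q) invfM invrK /c1; ring.
- rewrite /mu_tx /Npk /c2 invfM; ring.
- rewrite /c3 /sigma_tx -mulrA mul1r -sqrtrM.
    by congr (_ * Num.sqrt _); rewrite /Npk !invfM; ring.
  by rewrite !(mulr_ge0, invr_ge0) ?exprn_ge0 ?subr_ge0// ltW.
Qed.
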